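(* Let $\alpha\in\mathbb{C}$ with $|\alpha|=1$ and let $D$ be an $\alpha$-monograph of first kind. Then $\sigma_\alpha(D)=\sigma(\Gamma(D))$.
   Context: A mixed graph $D$ is obtained from a finite simple undirected graph $\Gamma(D)$ (its underlying graph) by replacing some edges by arcs: between any two vertices $u,v$ adjacent in $\Gamma(D)$ there is exactly one of a digon $u\sim v$, an arc $u\to v$, or an arc $v\to u$. For $|\alpha|=1$, $H^\alpha(D)=[h_{uv}]$ has $h_{uv}=1$ if $u\sim v$, $\alpha$ if $u\to v$, $\bar\alpha$ if $v\to u$, $0$ otherwise. $\sigma_\alpha(D)$ is the multiset of eigenvalues of $H^\alpha(D)$, $\sigma(\Gamma(D))$ that of the ordinary adjacency matrix of $\Gamma(D)$. A mixed walk $W=v_1,\dots,v_k$ (consecutive vertices adjacent in $\Gamma(D)$) has value $h_\alpha(W)=h_{v_1v_2}\cdots h_{v_{k-1}v_k}$. For a cycle $C$ of $\Gamma(D)$ with vertices $v_1,\dots,v_\ell$ in cyclic order, a traversal $\vec C$ is the closed walk $v_1,\dots,v_\ell,v_1$ (either direction, any start). $D$ is an $\alpha$-monograph of first kind if $h_\alpha(\vec C)=1$ for every cycle $C$ of $\Gamma(D)$ and every traversal $\vec C$. *)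

(* Defs.v *)
From mathcomp Require Import all_boot all_order all_algebra.
From mathcomp Require Import complex reals.
From mathcomp Require Import finmap multiset.

Set Implicit Arguments.
Unset Strict Implicit.
Unset Printing Implicit Defensive.

Import GRing.Theory Num.Theory.

Local Open Scope mset_scope.
Local Open Scope ring_scope.

Record simple_graph (V : finType) := SimpleGraph {
  adj : rel V;
  adj_sym : symmetric adj;
  adj_irrefl : irreflexive adj
}.

Record mixed_graph (V : finType) := MixedGraph {
  underlying : simple_graph V;
  arc : rel V;
  arc_adj : forall u v, arc u v -> adj underlying u v;
  arc_asym : forall u v, arc u v -> ~~ arc v u
}.

Definition digon (V : finType) (D : mixed_graph V) (u v : V) : bool :=
  [&& adj (underlying D) u v, ~~ arc D u v & ~~ arc D v u].

Definition hentry (C : numClosedFieldType) (V : finType) (alpha : C)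
    (D : mixed_graph V) (u v : V) : C :=
  if digon D u v then 1
  else if arc D u v then alpha
  else if arc D v u then alpha^*
  else 0.

(* Matrix rows and columns are indexed by the vertices through the
   enumeration [enum_val] of the vertex type. *)
Definition hermitian_adjacency (C : numClosedFieldType) (V : finType)
    (alpha : C) (D : mixed_graph V) : 'M[C]_#|V| :=
  \matrix_(i, j) hentry alpha D (enum_val i) (enum_val j).

Definition adjacency (C : numClosedFieldType) (V : finType)
    (G : simple_graph V) : 'M[C]_#|V| :=
  \matrix_(i, j) (adj G (enum_val i) (enum_val j))%:R.

(* Eigenvalues counted with algebraic multiplicity: the multiset of roots of
   the characteristic polynomial. *)
Definition spectrum (C : numClosedFieldType) (n : nat) (A : 'M[C]_n) :
    {mset C} :=
  seq_mset (sval (closed_field_poly_normal (char_poly A))).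

Definition walk_value (C : numClosedFieldType) (V : finType) (alpha : C)
    (D : mixed_graph V) (W : seq V) : C :=
  if W is v :: s then \prod_(h <- pairmap (hentry alpha D) v s) h else 1.

(* A cycle is given by its vertices listed in cyclic order, without repeating
   the first vertex at the end. *)
Definition graph_cycle (V : finType) (G : simple_graph V) (c : seq V) : bool :=
  (2 < size c)%N && ucycleb (adj G) c.

Definition closed_walk (V : finType) (c : seq V) : seq V :=
  if c is v :: s then v :: rcons s v else [::].

(* [W] goes once around the cycle [c], from any start, in either direction. *)
Definition traversal (V : finType) (c W : seq V) : Prop :=
  exists k : nat, W = closed_walk (rot k c) \/ W = closed_walk (rot k (rev c)).

Definition monograph_first_kind (C : numClosedFieldType) (V : finType)
    (alpha : C) (D : mixed_graph V) : Prop :=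
  forall c W : seq V, graph_cycle (underlying D) c -> traversal c W ->
    walk_value alpha D W = 1.

(* Main.v *)
(** Every closed walk has value 1: one that repeats a vertex splits there into
    two shorter closed walks, and one that does not is a backtracking edge or a
    cycle. Hence the value of a walk depends on its endpoints only, and with
    [d u] the value of a walk from [u] to the root of its component, conjugation
    by the diagonal matrix [d] turns the adjacency matrix of the underlying
    graph into the Hermitian one. *)
Require Import Defs.
From mathcomp Require Import all_boot all_order all_algebra.
From mathcomp Require Import complex reals.

Set Implicit Arguments.
Unset Strict Implicit.
Unset Printing Implicit Defensive.

Import GRing.Theory Num.Theory.

Local Open Scope ring_scope.

Definition path_weight (F : pzSemiRingType) (T : Type) (h : T -> T -> F)
    (x : T) (p : seq T) : F :=
  \prod_(a <- pairmap h x p) a.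

Lemma path_weight_cons (F : pzSemiRingType) (T : Type) (h : T -> T -> F) x y p :
  path_weight h x (y :: p) = h x y * path_weight h y p.
Proof. by rewrite /path_weight /= big_cons. Qed.

Lemma path_weight_cat (F : pzSemiRingType) (T : Type) (h : T -> T -> F) x p q :
  path_weight h x (p ++ q) = path_weight h x p * path_weight h (last x p) q.
Proof. by rewrite /path_weight pairmap_cat big_cat. Qed.

Lemma not_uniq_split (T : eqType) (s : seq T) :
  ~~ uniq s -> exists y s1 s2 s3, s = s1 ++ y :: s2 ++ y :: s3.
Proof.
elim: s => //= x s IHs; rewrite negb_and negbK.
have [/path.splitPr [s2 s3] _|_ /= /IHs [y [s1 [s2 [s3 ->]]]]] := boolP (x \in s).
  by exists x, [::], s2, s3.
by exists y, (x :: s1), s2, s3.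
Qed.

Section Potential.

Variables (F : comNzRingType) (T : finType) (e : rel T) (h : T -> T -> F).
Hypotheses (e_sym : symmetric e) (e_irr : irreflexive e).
Hypothesis h_edge : forall u v, e u v -> h u v * h v u = 1.
Hypothesis h_cycle : forall x p, (1 < size p)%N -> ucycleb e (x :: p) ->
  path_weight h x (rcons p x) = 1.

Lemma closed_path_weight x p :
  path e x p -> last x p = x -> path_weight h x p = 1.
Proof.
have [n] := ubnP (size p); elim: n x p => // n IHn x p ltpn xp lastp.
(* The list [p] omits the start [x] but, unless empty, ends at it, so [uniq p] says that the closed
   walk repeats no vertex apart from its return to [x]. *)
have [p_uniq|/not_uniq_split [y [p1 [p2 [p3 Dp]]]]] := boolP (uniq p).
  case/lastP: p => [|p z] in ltpn xp lastp p_uniq *.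
    by rewrite /path_weight big_nil.
  rewrite last_rcons in lastp; subst z.
  (* Here [p] holds only the interior vertices: none would be a loop at [x], one gives the
     backtracking walk [x], [y], [x], and two or more give a genuine cycle. *)
  case: p => [|y [|z p]] in ltpn xp p_uniq *.
  - by rewrite /= e_irr in xp.
  - case/and3P: xp => xy _ _.
    by rewrite !path_weight_cons /path_weight big_nil mulr1 h_edge // e_sym.
  - apply: h_cycle => //; rewrite /ucycleb [cycle _ _]xp.
    by rewrite rcons_uniq in p_uniq.
move: xp lastp ltpn; rewrite {p}Dp.
rewrite cat_path /= cat_path /= last_cat /= last_cat /=.
case/and5P=> xp1 p1y yp2 p2y yp3 lastp3.
rewrite !size_cat /= size_cat /= => ltpn.
(* Cutting at the two visits to [y] leaves the excursion from [y] back to [y] and the walk that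
   skips it; both are strictly shorter. *)
have loop : path_weight h y (rcons p2 y) = 1.
  apply: IHn; rewrite ?last_rcons // ?rcons_path ?yp2 //.
  rewrite size_rcons -ltnS; apply: leq_ltn_trans ltpn.
  by rewrite !addnS !ltnS addnCA leq_addr.
have rest : path_weight h x (p1 ++ y :: p3) = 1.
  apply: IHn; rewrite ?last_cat // ?cat_path /= ?xp1 ?p1y //.
  rewrite size_cat /= -ltnS; apply: leq_ltn_trans ltpn.
  by rewrite !addnS !ltnS addnA leq_add2r leq_addr.
rewrite -rest -(cat_rcons y p2) !(path_weight_cat, path_weight_cons).
by rewrite last_rcons loop mul1r.
Qed.

(** Inverses need not exist in [F], so [d'] supplies them: [d u] is the weight of a path from [u] to
    its root, [d' u] that of an independently chosen path back, and the two together close up. *)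
Lemma potential_exists : exists d d' : T -> F,
  (forall u, d u * d' u = 1) /\ (forall u v, e u v -> h u v * d v = d u).
Proof.
have connC : connect_sym e by apply: sym_connect_sym.
pose r := fingraph.root e.
have /fin_all_exists[p /all_and2[path_p last_p]] u :
    exists p, path e u p /\ last u p = r u.
  by have /connectP[p up Dr] := connect_root e u; exists p; split.
have /fin_all_exists[q /all_and2[path_q last_q]] u :
    exists q, path e (r u) q /\ last (r u) q = u.
  have /connectP[q uq Du] : connect e (r u) u by rewrite connC connect_root.
  by exists q; split.
pose d u := path_weight h u (p u).
pose d' u := path_weight h (r u) (q u).
have dK u : d u * d' u = 1.
  rewrite /d /d' -last_p -path_weight_cat.
  by apply: closed_path_weight; rewrite ?cat_path ?last_cat last_p ?path_p /=.
exists d, d'; split=> // u v uv.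
have r_uv : r u = r v by apply/eqP; rewrite root_connect // connect1.
(* The product is the weight of the closed walk that steps from [u] to [v], goes on to the common
   root, then returns to [u]. *)
suff huvd : h u v * d v * d' u = 1.
  by rewrite -[LHS]mulr1 -(dK u) [d u * _]mulrC mulrA huvd mul1r.
rewrite /d /d' -path_weight_cons r_uv -last_p.
rewrite -[last v _]/(last u (v :: p v)) -path_weight_cat.
apply: closed_path_weight; last by rewrite last_cat /= last_p -r_uv last_q.
by rewrite cat_path /= uv path_p last_p -r_uv path_q.
Qed.

End Potential.

(** No inverse of [P] is needed: the intertwining relation extends to the characteristic matrices,
    and the nonzero constant [\det P] cancels in the domain of polynomials. *)
Lemma char_poly_similar (F : idomainType) (n : nat) (A B P : 'M[F]_n) :
  \det P != 0 -> A *m P = P *m B -> char_poly A = char_poly B.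
Proof.
rewrite -polyC_eq0 -det_map_mx => P_neq0 AP.
apply: (mulIf P_neq0); rewrite [RHS]mulrC -!det_mulmx; congr (\det _).
by rewrite mulmxBl mulmxBr -!map_mxM AP scalar_mxC.
Qed.

Lemma hentry_nonadj (C : numClosedFieldType) (V : finType) (alpha : C)
    (D : mixed_graph V) u v :
  ~~ adj (underlying D) u v -> hentry alpha D u v = 0.
Proof.
move=> uv; rewrite /hentry /digon (negPf uv) /=.
case: ifP => [/arc_adj|_]; first by rewrite (negPf uv).
by case: ifP => // /arc_adj; rewrite adj_sym (negPf uv).
Qed.

Lemma hentry_edge (C : numClosedFieldType) (V : finType) (alpha : C)
    (D : mixed_graph V) u v :
  `|alpha| = 1 -> adj (underlying D) u v ->
  hentry alpha D u v * hentry alpha D v u = 1.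
Proof.
move=> alpha1 uv; have alphaK : alpha * alpha^* = 1.
  by rewrite -normCK alpha1 expr1n.
rewrite /hentry /digon [adj _ v u]adj_sym uv /=.
have := @Defs.arc_asym _ D u v.
case: (Defs.arc D u v) => [/(_ isT)/negPf-> //|_].
by case: (Defs.arc D v u); rewrite /= ?mulr1 // mulrC.
Qed.

Theorem theorem4p5 (R : realType) (V : finType) (alpha : R[i])
    (D : mixed_graph V) (Halpha : `|alpha| = 1)
    (HD : monograph_first_kind alpha D) :
  spectrum (hermitian_adjacency alpha D) =
  spectrum (adjacency R[i] (underlying D)).
Proof.
rewrite /spectrum.
suff -> : char_poly (hermitian_adjacency alpha D) =
          char_poly (adjacency R[i] (underlying D)) by [].
have h_cycle x p : (1 < size p)%N -> ucycleb (adj (underlying D)) (x :: p) ->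
    path_weight (hentry alpha D) x (rcons p x) = 1.
  move=> ltp xp; apply: (HD (x :: p) (x :: rcons p x)).
    exact/andP.
  by exists 0; left; rewrite rot0.
have [d [d' [dK hd]]] := potential_exists (@adj_sym _ (underlying D))
  (@adj_irrefl _ _) (fun u v => hentry_edge Halpha) h_cycle.
apply: (@char_poly_similar _ _ _ _ (diag_mx (\row_i d (enum_val i)))).
  rewrite det_diag; apply/prodf_neq0 => i _; rewrite mxE.
  by apply/eqP=> d0; move/eqP: (dK (enum_val i)); rewrite d0 mul0r eq_sym oner_eq0.
(* Entrywise, this compares [h u v * d v] with [d u] times the 0-1 adjacency entry. *)
apply/matrixP=> i j; rewrite mul_mx_diag mul_diag_mx !mxE.
have [uv|uv] := boolP (adj _ _ _); first by rewrite hd // mulr1.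
by rewrite hentry_nonadj // mul0r mulr0.
Qed.
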